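(* Let $M$ and $N$ be matroids having neither loops nor coloops. Let $\{P_1,\ldots,P_d\}$ be a partition of the set of all chains (including the empty chain) in $\mathcal{Z}^{\circ}(M)$, and let $\{Q_1,\ldots,Q_d\}$ be a partition of the set of all chains in $\mathcal{Z}^{\circ}(N)$. If $\mathrm{comp}(\mathrm{fl}_M(P_i))=\mathrm{comp}(\mathrm{fl}_N(Q_i))$ for each $i\in[d]$, then $\mathcal{G}(M)=\mathcal{G}(N)$.
   Context: All matroids are finite. A cyclic flat is a flat that is a (possibly empty) union of circuits; for a matroid with neither loops nor coloops, $\emptyset$ and $E(M)$ are cyclic flats, and $\mathcal{Z}^{\circ}(M)$ is the set of nonempty proper cyclic flats, ordered by inclusion. A flag of a rank-$k$ matroid $M$ is a sequence $(X_0,X_1,\ldots,X_k)$ with $X_i$ a rank-$i$ flat and $X_i\subsetneq X_{i+1}$; its composition is $(|X_0|,|X_1-X_0|,\ldots,|X_k-X_{k-1}|)$. The reduced cyclic chain of a flag of a matroid with neither loops nor coloops is obtained by removing from each $X_i$ the coloops of $M|X_i$ (giving a chain of cyclic flats) and then discarding $\emptyset$ and $E(M)$. For a chain $C$ in $\mathcal{Z}^{\circ}(M)$, $\mathrm{fl}_M(C)$ is the set of flags whose reduced cyclic chain is $C$; for a set $T$ of chains, $\mathrm{fl}_M(T)=\bigcup_{C\in T}\mathrm{fl}_M(C)$; for a set $S$ of flags, $\mathrm{comp}(S)$ is the multiset of their compositions. The $\mathcal{G}$-invariant: for a permutation $e_1,\ldots,e_n$ of $E(M)$ the rank sequence is $r_1\cdots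 r_n$ with $r_i=r(\{e_1,\ldots,e_i\})-r(\{e_1,\ldots,e_{i-1}\})$, and $\mathcal{G}(M)=\sum_\pi[\underline r(\pi)]$, a formal sum of basis symbols indexed by $0/1$-sequences, over a field of characteristic zero. *)

(* Defs.v *)
From mathcomp Require Import all_boot all_order all_algebra.
From mathcomp Require Import finmap multiset.
From mathcomp Require Import monalg.

Set Implicit Arguments.
Unset Strict Implicit.
Unset Printing Implicit Defensive.

Local Open Scope nat_scope.

(* A matroid whose ground set is the finite type [E] (so that E(M) is [setT]),
   given by its rank function. *)
Record matroid (E : finType) := Matroid {
  rank : {set E} -> nat;
  rank_le_card : forall A, rank A <= #|A|;
  rank_mono : forall A B : {set E}, A \subset B -> rank A <= rank B;
  rank_submod : forall A B : {set E},
    rank (A :|: B) + rank (A :&: B) <= rank A + rank B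
}.

Section Restriction.
Variables (E : finType) (M : matroid E) (X : {set E}).
Implicit Types A B : {set {x | x \in X}}.

Definition restr_rank A : nat := rank M (val @: A).

Lemma restr_rank_le_card A : restr_rank A <= #|A|.
Proof.
by rewrite -(card_imset (mem A) (@val_inj _ _ {x | x \in X})) rank_le_card.
Qed.

Lemma restr_rank_mono A B : A \subset B -> restr_rank A <= restr_rank B.
Proof. by move=> sAB; apply/rank_mono/imsetS. Qed.

Lemma restr_rank_submod A B :
  restr_rank (A :|: B) + restr_rank (A :&: B) <= restr_rank A + restr_rank B.
Proof.
rewrite /restr_rank imsetU imsetI; first exact: rank_submod.
by move=> x y _ _; apply: val_inj.
Qed.

(* The restriction M|X. *)
Definition restriction : matroid {x | x \in X} :=
  Matroid restr_rank_le_card restr_rank_mono restr_rank_submod.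

End Restriction.

Section MatroidNotions.
Variables (E : finType) (M : matroid E).
Implicit Types (A X I B F : {set E}) (C : {set {set E}}).

Definition indep I : bool := rank M I == #|I|.
Definition basis B : bool := maxset indep B.
Definition circuit A : bool := minset (fun X => ~~ indep X) A.

Definition loops : {set E} := [set x | circuit [set x]].
Definition coloops : {set E} := [set x | [forall B, basis B ==> (x \in B)]].

Definition flat F : bool :=
  [forall x, (x \notin F) ==> (rank M F < rank M (x |: F))].

(* [T] may be empty. *)
Definition cyclic_flat F : bool :=
  flat F && [exists T : {set {set E}}, [forall A in T, circuit A] && (F == cover T)].

(* The nonempty proper cyclic flats. *)
Definition Zcirc : {set {set E}} :=
  [set F | [&& cyclic_flat F, F != set0 & F != setT]].

(* The chains in [Zcirc], as totally ordered subsets; the empty one included. *)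
Definition chains : {set {set {set E}}} :=
  [set C : {set {set E}} | (C \subset Zcirc) &&
     [forall A in C, forall B in C, (A \subset B) || (B \subset A)]].

End MatroidNotions.

Section Flags.
Variables (E : finType) (M : matroid E).

(* Sequences (X_0, ..., X_k) of sets, k being the rank of M. *)
Definition flagseq := ((rank M setT).+1).-tuple {set E}.

Definition is_flag (X : flagseq) : bool :=
  [forall i, flat M (tnth X i) && (rank M (tnth X i) == i)]
  && sorted (fun A B : {set E} => A \proper B) X.

(* (|X_0|, |X_1 - X_0|, ..., |X_k - X_(k-1)|), the first entry being written
   |X_0 - set0|. *)
Definition composition (X : flagseq) : seq nat :=
  pairmap (fun A B : {set E} => #|B :\: A|) set0 X.

Definition drop_coloops (X : {set E}) : {set E} :=
  X :\: (val @: coloops (restriction M X)).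

Definition reduced_cyclic_chain (X : flagseq) : {set {set E}} :=
  [set drop_coloops A | A in (X : seq {set E})] :\: [set set0; setT].

Definition fl (C : {set {set E}}) : {set flagseq} :=
  [set X | is_flag X && (reduced_cyclic_chain X == C)].

Definition fl_set (T : {set {set {set E}}}) : {set flagseq} :=
  \bigcup_(C in T) fl C.

Definition comp_mset (S : {set flagseq}) : {mset seq nat}%mset :=
  seq_mset [seq composition X | X <- enum S].

End Flags.

Section GInvariant.
Variables (E : finType) (M : matroid E).
Local Open Scope ring_scope.

(* For e = (e_1, ..., e_n) the i-th entry is r{e_1..e_i} - r{e_1..e_(i-1)};
   this number is 0 or 1, and is recorded as a boolean (1 being [true]). *)
Definition rank_sequence (e : seq E) : seq bool :=
  [seq (rank M [set x in take i e] - rank M [set x in take i.-1 e] == 1)%N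
     | i <- iota 1 (size e)].

(* An element of the K-vector space with basis the symbols << s >>, for s a
   0/1-sequence (of any length); the permutations of E(M) are the orderings of
   its elements without repetition. *)
Definition Ginv (K : fieldType) : {malg K[seq bool]} :=
  \sum_(e : #|E|.-tuple E | uniq e) << rank_sequence e >>.

End GInvariant.

(* Main.v *)
Require Import Defs.
From mathcomp Require Import all_boot all_order all_algebra.
From mathcomp Require Import finmap multiset.
From mathcomp Require Import monalg.
From mathcomp Require Import zify.

(* Every ordering of E(M) builds up exactly one flag, namely the closures of its
   prefixes.  Label each element by the index of the first member of that flag
   containing it: the rank sequence of the ordering, and the fact that it builds
   up this flag, can both be read off the word of labels.  The multiset of labels
   is the composition of the flag, so G(M) is the sum over all flags of an element
   depending only on the composition.  Finally, removing coloops from a flat X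
   leaves the union of the circuits inside X, which is a cyclic flat increasing
   with X; hence every flag has its reduced cyclic chain among the chains of
   Z°(M), and the flags are partitioned by the blocks P_i. *)

Set Implicit Arguments.
Unset Strict Implicit.
Unset Printing Implicit Defensive.

Local Open Scope nat_scope.

(** * Closure and circuits from the rank function *)

Section RankTheory.
Variables (E : finType) (M : matroid E).
Implicit Types (A B I F X : {set E}) (x y : E).

Lemma rank0 : rank M set0 = 0.
Proof. by apply/eqP; rewrite -leqn0 -(cards0 E) rank_le_card. Qed.

Lemma rank_setU1 x A : rank M (x |: A) <= (rank M A).+1.
Proof.
have := rank_submod M [set x] A; have := rank_le_card M [set x].
by rewrite cards1; lia.
Qed.

Lemma rank_setU1_mono x A B :
  A \subset B -> x \notin B -> rank M B < rank M (x |: B) ->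
  rank M A < rank M (x |: A).
Proof.
move=> sAB xB ltB; have := rank_submod M (x |: A) B.
have -> : (x |: A) :|: B = x |: B by rewrite -setUA (setUidPr sAB).
have -> : (x |: A) :&: B = A; last by lia.
apply/setP=> z; rewrite !inE; have [-> | _] := eqVneq z x.
  by rewrite (negPf xB) (contraNF (subsetP sAB x) xB).
by case zA: (z \in A) => //=; rewrite (subsetP sAB).
Qed.

(** Induction on [#|B|]: both [A :|: B :\ x] and [x |: A] have the rank of [A], and their
    intersection contains [A], so submodularity bounds the rank of their union. *)
Lemma rank_setU_absorb A B :
  (forall x, x \in B -> rank M (x |: A) = rank M A) ->
  rank M (A :|: B) = rank M A.
Proof.
have [n] := ubnP #|B|; elim: n B => // n IHn B leBn absB.
have [->|[x xB]] := set_0Vmem B; first by rewrite setU0.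
have IH : rank M (A :|: B :\ x) = rank M A.
  apply: IHn => [|z /setD1P[_ /absB]] //.
  by move: leBn; rewrite (cardsD1 x) xB.
have := rank_submod M (A :|: B :\ x) (x |: A); rewrite IH absB //.
have -> : A :|: B :\ x :|: (x |: A) = A :|: B.
  by rewrite setUA -(setUA A) [_ :|: [set x]]setUC setD1K // setUAC setUid.
have := @rank_mono _ M A ((A :|: B :\ x) :&: (x |: A)).
rewrite subsetI subsetUl subsetUr => /(_ isT).
by have := rank_mono M (subsetUl A B); lia.
Qed.

Lemma indepW A B : A \subset B -> indep M B -> indep M A.
Proof.
move=> sAB /eqP rB; rewrite /indep eqn_leq rank_le_card /=.
have := rank_submod M (B :&: A) (B :\: A); rewrite setID rB.
have := rank_le_card M (B :\: A); have := cardsID A B.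
by rewrite (setIidPr sAB); lia.
Qed.

Lemma indep_set0 : indep M set0.
Proof. by rewrite /indep rank0 cards0. Qed.

Lemma circuit_of_dependent x I :
  indep M I -> ~~ indep M (x |: I) ->
  exists2 C, circuit M C & (x \in C) && (C \subset x |: I).
Proof.
move=> iI /(@minset_exists _ (fun X => ~~ indep M X))[C cC sC].
exists C => //; rewrite sC andbT; apply/negPn/negP=> xC.
have /minsetp/negP[] := cC; apply: indepW iI.
apply/subsetP=> z zC; have := subsetP sC z zC; rewrite !inE.
by case: eqP => // zx; rewrite -zx zC in xC.
Qed.

(** A maximal independent subset [I] of [A] has the rank of [A], so [x |: I] is dependent; a minimal
    dependent subset of it must use [x]. *)
Lemma circuit_of_cl x A :
  x \notin A -> rank M (x |: A) = rank M A ->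
  exists2 C, circuit M C & (x \in C) && (C \subset x |: A).
Proof.
move=> xA eA.
have [I /maxsetP[/andP[iI sI] maxI] _] :
    {I | maxset (fun I => indep M I && (I \subset A)) I & set0 \subset I}.
  by apply: maxset_exists; rewrite indep_set0 sub0set.
(* An element of [A] raising the rank of [I] could be added to [I], against maximality. *)
have rIA : rank M A = rank M I.
  rewrite -(setUidPr sI); apply: rank_setU_absorb => z zA.
  have [zI | zI] := boolP (z \in I); first by rewrite (setUidPr _) ?sub1set.
  have := rank_mono M (subsetUr [set z] I); rewrite leq_eqVlt => /predU1P[-> //|].
  have := rank_le_card M (z |: I); rewrite cardsU1 zI add1n.
  move/eqP: (iI) => rI lt1; rewrite rI => lt2.
  have /maxI/(_ (subsetUr _ _)) eI :
      indep M (z |: I) && (z |: I \subset A).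
    by rewrite subUset sub1set zA sI /indep cardsU1 zI eqn_leq lt2 lt1.
  by rewrite -eI setU11 in zI.
have [|C cC /andP[xC sC]] := @circuit_of_dependent x I iI.
  rewrite /indep neq_ltn cardsU1 (contraNN (subsetP sI x) xA) add1n ltnS.
  by rewrite -(eqP iI) -rIA -eA rank_mono ?setUS.
by exists C; rewrite // xC (subset_trans sC) ?setUS.
Qed.

Definition cl A : {set E} := [set x | rank M (x |: A) == rank M A].

Lemma sub_cl A : A \subset cl A.
Proof. by apply/subsetP=> x xA; rewrite inE (setUidPr _) ?sub1set. Qed.

Lemma rank_cl A : rank M (cl A) = rank M A.
Proof.
rewrite -(setUidPr (sub_cl A)); apply: rank_setU_absorb => x.
by rewrite inE => /eqP.
Qed.

Lemma flat_cl A : flat M (cl A).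
Proof.
apply/forallP=> x; apply/implyP; rewrite inE rank_cl => neA.
have lt : rank M A < rank M (x |: A).
  by rewrite ltn_neqAle eq_sym neA rank_mono ?subsetUr.
exact/(leq_trans lt)/rank_mono/setUS/sub_cl.
Qed.

Lemma cl_sub_flat A F : flat M F -> A \subset F -> cl A \subset F.
Proof.
move=> /forallP flF sAF; apply/subsetP=> x; rewrite inE => /eqP rA.
apply/negPn/negP=> xF; have := implyP (flF x) xF.
by move/(rank_setU1_mono sAF xF); rewrite rA ltnn.
Qed.

Lemma cl_eq_flat A F :
  flat M F -> A \subset F -> rank M A = rank M F -> cl A = F.
Proof.
move=> flF sAF rAF; apply/eqP; rewrite eqEsubset cl_sub_flat //=.
apply/subsetP=> x xF; rewrite inE eqn_leq [rank M A <= _]rank_mono ?subsetUr // andbT.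
by rewrite rAF rank_mono // subUset sub1set xF.
Qed.

Lemma clS A B : A \subset B -> cl A \subset cl B.
Proof.
move=> sAB; apply: cl_sub_flat (flat_cl B) _.
exact: subset_trans sAB (sub_cl B).
Qed.

Lemma cl_eq A B : A \subset B -> rank M A = rank M B -> cl A = cl B.
Proof.
move=> sAB rAB; apply: cl_eq_flat (flat_cl B) _ _.
  exact: subset_trans sAB (sub_cl B).
by rewrite rank_cl.
Qed.

End RankTheory.

(** * Removal of coloops and cyclic flats *)

Section CyclicPart.
Variables (E : finType) (M : matroid E).
Implicit Types (A X Y F C : {set E}).

Lemma indep_restriction X (I : {set {x | x \in X}}) :
  indep (restriction M X) I = indep M (val @: I).
Proof. by rewrite /indep card_imset //; apply: val_inj. Qed.

(** If [x] is not a coloop, some basis of the restriction avoids [x], and adding [x] to it creates a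
    circuit through [x]. Conversely, for a circuit [C] through [x], the independent set [C :\ x]
    extends to a basis; were [x] a coloop, that basis would contain all of [C]. *)
Lemma mem_drop_coloops X x :
  reflect (exists2 C, circuit M C & (x \in C) && (C \subset X))
          (x \in drop_coloops M X).
Proof.
rewrite inE; apply: (iffP andP) => [[xcol xX]|[C cC /andP[xC sC]]].
  have {xcol} : Sub x xX \notin coloops (restriction M X).
    by apply: contra xcol => xcol; apply/imsetP; exists (Sub x xX).
  rewrite inE negb_forall => /existsP[B]; rewrite negb_imply.
  case/andP=> /maxsetP[iB maxB] xB.
  have [||C cC /andP[xC sC]] := @circuit_of_dependent _ M x (val @: B).
  - by rewrite -indep_restriction.
  - apply: contra xB => ixB.
    rewrite -(maxB (Sub x xX |: B)) ?setU11 ?subsetUr //.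
    by rewrite indep_restriction imsetU1.
  exists C; rewrite // xC (subset_trans sC) //.
  rewrite subUset sub1set xX; apply/subsetP=> _ /imsetP[z _ ->]; exact: valP.
have xX := subsetP sC x xC; split=> //.
apply/imsetP=> -[z zcol xz]; move: zcol.
have [/negP depC minC] := minsetP cC.
have iC' : indep M (C :\ x).
  apply/negPn/negP=> dC'; have /setP/(_ x) := minC _ dC' (subsetDl _ _).
  by rewrite !inE eqxx xC.
pose I : {set {x | x \in X}} := [set z | val z \in C :\ x].
have vI : val @: I = C :\ x.
  apply/setP=> y; apply/imsetP/idP=> [[w + ->]|yC]; first by rewrite inE.
  have yX : y \in X by move: yC; rewrite inE => /andP[_ /(subsetP sC)].
  by exists (Sub y yX); rewrite ?inE //= in yC *.
have iI : indep (restriction M X) I by rewrite indep_restriction vI.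
have [B maxB sIB] := maxset_exists iI.
rewrite inE => /forallP/(_ B); rewrite /basis maxB /= => zB.
have iB : indep M (val @: B).
  by rewrite -indep_restriction; have [] := maxsetP maxB.
apply: depC; apply: indepW iB; apply/subsetP=> y yC.
have [->|yx] := eqVneq y x; first by rewrite xz imset_f.
have : y \in C :\ x by rewrite !inE yx.
by rewrite -vI; apply/subsetP/imsetS.
Qed.

Lemma drop_coloopsS X Y : X \subset Y -> drop_coloops M X \subset drop_coloops M Y.
Proof.
move=> sXY; apply/subsetP=> x /mem_drop_coloops[C cC /andP[xC sC]].
by apply/mem_drop_coloops; exists C; rewrite // xC (subset_trans sC).
Qed.

(** Flatness: a point outside [F] raises the rank of every subset of [F], and a point of [F] not
    raising the rank of the cyclic part would lie on a circuit inside [F], hence in the cyclic part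
    already. *)
Lemma cyclic_flat_drop_coloops F : flat M F -> cyclic_flat M (drop_coloops M F).
Proof.
move=> flF; apply/andP; split; last first.
  apply/existsP; exists [set C | circuit M C & C \subset F]; apply/andP; split.
    by apply/forall_inP=> C; rewrite inE => /andP[].
  apply/eqP/setP=> x; apply/mem_drop_coloops/bigcupP.
    by case=> C cC /andP[xC sC]; exists C; rewrite // inE cC.
  by case=> C; rewrite inE => /andP[cC sC] xC; exists C; rewrite // xC.
have sF : drop_coloops M F \subset F by rewrite subsetDl.
apply/forallP=> x; apply/implyP=> xF'.
have [xF|xF] := boolP (x \in F); last first.
  by apply: (rank_setU1_mono sF xF); have := forallP flF x; rewrite xF.
rewrite ltn_neqAle rank_mono ?subsetUr // andbT.
apply/negP=> /eqP/esym; case/(circuit_of_cl xF')=> C cC /andP[xC sC].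
case/mem_drop_coloops: xF'; exists C; rewrite // xC.
by rewrite (subset_trans sC) // subUset sub1set xF.
Qed.

Lemma reduced_cyclic_chain_chains (X : flagseq M) :
  is_flag X -> reduced_cyclic_chain X \in chains M.
Proof.
case/andP=> /forallP flX sX; rewrite inE; apply/andP; split.
  apply/subsetP=> A /setDP[/imsetP[B /tnthP[i ->] ->]]; rewrite !inE => /norP[-> ->].
  by rewrite !andbT cyclic_flat_drop_coloops //; case/andP: (flX i).
have chain A B : A \in (X : seq _) -> B \in (X : seq _) ->
    (A \subset B) || (B \subset A).
  have tr : transitive (fun A B : {set E} => A \proper B).
    by move=> ? ? ?; apply: proper_trans.
  move=> /(nthP set0)[i ltiX <-] /(nthP set0)[j ltjX <-].
  case: (ltngtP i j) => [ltij|ltji|->]; last by rewrite subxx.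
    by rewrite proper_sub // (sorted_ltn_nth tr).
  by rewrite orbC proper_sub // (sorted_ltn_nth tr).
apply/forall_inP=> A /setDP[/imsetP[A' XA ->] _].
apply/forall_inP=> B /setDP[/imsetP[B' XB ->] _].
by case/orP: (chain _ _ XA XB) => /drop_coloopsS ->; rewrite ?orbT.
Qed.

End CyclicPart.

(** * Words of levels and sums over their arrangements *)

Section Words.

(** On the levels of a set of elements, this is the index of the first flag member containing the
    set; the empty word gives 0. *)
Definition top (w : seq nat) : nat := \max_(a <- w) a.

(** The test for an ordering to build up the flag: no new element may skip a member of the flag. *)
Definition slow (w : seq nat) : bool :=
  all (fun j => top (take j.+1 w) <= (top (take j w)).+1) (iota 0 (size w)).

Definition jumps (w : seq nat) : seq bool :=
  [seq top (take i w) - top (take i.-1 w) == 1 | i <- iota 1 (size w)].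

(* The word is sorted so that it depends only on its multiset of letters. *)
Definition comp_word (c : seq nat) : seq nat :=
  sort leq (flatten [seq nseq (nth 0 c i) i | i <- iota 0 (size c)]).

Lemma count_mem_blocks (c : seq nat) i :
  count_mem i (flatten [seq nseq (nth 0 c i) i | i <- iota 0 (size c)])
    = nth 0 c i.
Proof.
rewrite count_flatten -map_comp sumnE big_map.
have [ltic|leci] := ltnP i (size c).
  rewrite (bigD1_seq i) ?iota_uniq ?mem_iota //= big1 => [|j ji].
    by rewrite count_nseq /= eqxx mul1n addn0.
  by rewrite count_nseq /= (negPf ji).
rewrite nth_default // big1_seq // => j /=.
rewrite mem_iota add0n count_nseq /= => ltj.
by case: eqP => // ji; lia.
Qed.

Variables (V : nmodType) (H : seq nat -> V).

(** Positions are permuted, not letters, so equal letters stay distinguishable, just as elements of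
    equal level do in an ordering of the ground set. *)
Definition sum_arrangements (w : seq nat) : V :=
  (\sum_(e : (size w).-tuple 'I_(size w) | uniq e) H [seq nth 0%N w (val i) | i <- e])%R.

Lemma sum_uniq_bij (A B : finType) (h : A -> B) m n (G : seq B -> V) :
  m = n -> bijective h ->
  (\sum_(e : n.-tuple B | uniq e) G e
     = \sum_(e : m.-tuple A | uniq e) G (map h e))%R.
Proof.
move=> -> bh; have [g hK gK] := bh.
rewrite (reindex (fun e : n.-tuple A => map_tuple h e)) /=; last first.
  exists (fun e : n.-tuple B => map_tuple g e) => e _; apply: val_inj => /=.
    by rewrite mapK.
  by rewrite mapK.
by apply: eq_bigl => e; rewrite map_inj_uniq //; apply: can_inj hK.
Qed.

(** Listing [T] by increasing [f] identifies its elements with the positions of the sorted word, so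
    the sum sees only the multiset of values of [f]. *)
Lemma sum_uniq_tuples (T : finType) (f : T -> nat) :
  (\sum_(e : #|T|.-tuple T | uniq e) H [seq f x | x <- e]
     = sum_arrangements (sort leq [seq f x | x <- enum T]))%R.
Proof.
rewrite sort_map; set s := sort _ _.
have us : uniq s by rewrite sort_uniq enum_uniq.
have sz : size s = #|T| by rewrite size_sort cardE.
pose h (i : 'I_(size [seq f x | x <- s])) := tnth (in_tuple s) (cast_ord (size_map f s) i).
have ih : injective h.
  by move=> i j /(tuple_uniqP (in_tuple s) us)/cast_ord_inj.
have bh : bijective h by apply: inj_card_bij; rewrite // card_ord size_map sz.
have eqn : size [seq f x | x <- s] = #|T| by rewrite size_map.
rewrite (sum_uniq_bij (fun e => H (map f e)) eqn bh).
apply: eq_bigr => e _; rewrite -map_comp; congr H; apply: eq_map => i /=.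
have x0 : T := h i; rewrite /h (tnth_nth x0) (nth_map x0) //=.
by rewrite -(size_map f).
Qed.

End Words.

(** * Levels of elements with respect to a flag *)

Section FlagLevels.
Variables (E : finType) (M : matroid E) (X : flagseq M).
Hypothesis flagX : is_flag X.
Implicit Types (x : E) (i j : nat) (e : seq E).

Definition level x : nat := find (fun A : {set E} => x \in A) X.

Lemma flat_flag i : i <= rank M setT -> flat M (nth set0 X i).
Proof.
rewrite -ltnS => lti; have /andP[/forallP/(_ (Ordinal lti))/andP[+ _] _] := flagX.
by rewrite (tnth_nth set0).
Qed.

Lemma rank_flag i : i <= rank M setT -> rank M (nth set0 X i) = i.
Proof.
rewrite -ltnS => lti; have /andP[/forallP/(_ (Ordinal lti))/andP[_ /eqP +] _] := flagX.
by rewrite (tnth_nth set0).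
Qed.

Lemma flag_mono i j :
  i <= j -> j <= rank M setT -> nth set0 X i \subset nth set0 X j.
Proof.
have tr : transitive (fun A B : {set E} => A \proper B).
  by move=> ? ? ?; apply: proper_trans.
rewrite leq_eqVlt => /predU1P[->//|ltij] lej; have /andP[_ sX] := flagX.
by apply/proper_sub/(sorted_ltn_nth tr) => //; rewrite inE size_tuple; lia.
Qed.

Lemma level_leq x i : i <= rank M setT -> (level x <= i) = (x \in nth set0 X i).
Proof.
move=> lei; apply/idP/idP=> [le_xi|xXi]; last first.
  by rewrite leqNgt; apply/negP=> /(before_find set0); rewrite xXi.
have hasx : has (fun A : {set E} => x \in A) X.
  by rewrite has_find size_tuple ltnS (leq_trans le_xi).
exact: (subsetP (flag_mono le_xi lei)) (nth_find set0 hasx).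
Qed.

(** An element missed by this flat would raise its rank above that of [setT]. *)
Lemma flag_last : nth set0 X (rank M setT) = setT.
Proof.
apply/setP=> x; rewrite inE; apply/negPn/negP=> xX.
have /forallP/(_ x) := flat_flag (leqnn _); rewrite xX rank_flag //= ltnNge.
by rewrite rank_mono ?subsetT.
Qed.

Lemma level_max x : level x <= rank M setT.
Proof. by rewrite level_leq // flag_last inE. Qed.

Lemma top_level_leq e i : i <= rank M setT ->
  (top [seq level x | x <- e] <= i) = ([set x in e] \subset nth set0 X i).
Proof.
move=> lei; rewrite /top big_map; apply/bigmax_leqP_seq/subsetP => le_i x.
  by rewrite inE => xe; rewrite -level_leq ?le_i.
by move=> xe _; rewrite level_leq ?le_i // inE.
Qed.

Lemma top_level_max e : top [seq level x | x <- e] <= rank M setT.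
Proof. by rewrite top_level_leq // flag_last subsetT. Qed.

Lemma count_level i :
  count_mem i [seq level x | x <- enum E] = nth 0 (composition X) i.
Proof.
have -> : count_mem i [seq level x | x <- enum E] = #|[pred x | level x == i]|.
  by rewrite count_map enumT -size_filter cardE.
(* Beyond the last index both sides vanish: no element has such a level, and [nth] returns its
   default 0. *)
have [lei|ltki] := leqP i (rank M setT); last first.
  rewrite nth_default ?size_pairmap ?size_tuple //; apply: eq_card0 => x.
  by rewrite !inE; apply/negP=> /eqP exi; have := level_max x; lia.
rewrite (nth_pairmap set0) ?size_tuple //; apply: eq_card => x; rewrite !inE.
case: i lei => [_|i lei] /=; first by rewrite inE -level_leq // leqn0.
by rewrite -!level_leq ?(ltnW lei) //; case: ltngtP; lia.
Qed.

Lemma sort_level : sort leq [seq level x | x <- enum E] = comp_word (composition X).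
Proof.
apply/(perm_sortP leq_total leq_trans anti_leq)/allP => i _ /=.
by rewrite count_level count_mem_blocks.
Qed.

End FlagLevels.

(** * The flag built up by an ordering *)

Section FlagOfOrdering.
Variables (E : finType) (M : matroid E).
Implicit Types (x : E) (i j : nat) (e : seq E) (X : flagseq M).

Local Notation prefix_set e j := [set x in take j e].

Lemma prefix_setS e j : j < size e ->
  exists2 x, take j.+1 e = rcons (take j e) x
           & prefix_set e j.+1 = x |: prefix_set e j.
Proof.
case: e => // x0 e ltj; exists (nth x0 (x0 :: e) j); first exact: take_nth.
by apply/setP=> x; rewrite (take_nth x0) // !inE mem_rcons inE.
Qed.

Lemma prefix_set_mono e i j : i <= j -> prefix_set e i \subset prefix_set e j.
Proof.
move=> leij; apply/subsetP=> x; rewrite !inE -(minn_idPl leij) take_min.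
by move/mem_take.
Qed.

Lemma rank_prefixS e j : j < size e ->
  rank M (prefix_set e j.+1) <= (rank M (prefix_set e j)).+1.
Proof. by case/prefix_setS=> x _ ->; apply: rank_setU1. Qed.

Lemma rank_prefix0 e : rank M (prefix_set e 0) = 0.
Proof.
by rewrite take0 set_nil rank0.
Qed.

(** A discrete intermediate value argument: prefix ranks start at 0 and grow by at most one per
    step. *)
Lemma prefix_rank_ivt e i m : m <= size e -> i <= rank M (prefix_set e m) ->
  exists2 j, j <= m & rank M (prefix_set e j) = i.
Proof.
elim: m => [|m IHm] lem; first by rewrite rank_prefix0 => lei; exists 0;
  rewrite ?rank_prefix0; lia.
move=> lei; have [le_im|lt_mi] := leqP i (rank M (prefix_set e m)).
  by have [j lej <-] := IHm (ltnW lem) le_im; exists j; lia.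
by exists m.+1 => //; have := rank_prefixS lem; lia.
Qed.

(** Any prefix of rank [i] would serve, since nested prefixes of equal rank have the same closure.
    For a full ordering and [i <= rank M setT] the default [ord0] is never reached. *)
Definition first_prefix e i : nat :=
  odflt ord0 [pick j : 'I_(size e).+1 | rank M (prefix_set e j) == i].

Definition flag_of e : flagseq M :=
  [tuple cl M (prefix_set e (first_prefix e i)) | i < (rank M setT).+1].

(* The closures of the prefixes of [e] run through the flag [X]. *)
Definition compatible X e : Prop := forall j, j <= size e ->
  rank M (prefix_set e j) = top [seq level X x | x <- take j e].

Section FullOrdering.
Variable e : seq E.
Hypothesis full_e : [set x in e] = setT.

Lemma first_prefixP i : i <= rank M setT ->
  first_prefix e i <= size e /\ rank M (prefix_set e (first_prefix e i)) = i.
Proof.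
move=> lei; rewrite /first_prefix; case: pickP => [j /eqP rj|no] /=.
  by rewrite -ltnS ltn_ord.
have [||j lej /eqP rj] := @prefix_rank_ivt e i (size e) => //.
  by rewrite take_size full_e.
by have := no (Ordinal (lej : j < (size e).+1)); rewrite /= rj.
Qed.

Lemma nth_flag_of i : i <= rank M setT ->
  nth set0 (flag_of e) i = cl M (prefix_set e (first_prefix e i)).
Proof.
rewrite -ltnS => lti; rewrite -[i]/(val (Ordinal lti)) -tnth_nth.
by rewrite tnth_mktuple.
Qed.

Lemma nth_flag_of_prefix j : j <= size e ->
  nth set0 (flag_of e) (rank M (prefix_set e j)) = cl M (prefix_set e j).
Proof.
move=> lej; set i := rank M (prefix_set e j).
have lei : i <= rank M setT by rewrite rank_mono ?subsetT.
rewrite nth_flag_of //; have [_ rj] := first_prefixP lei.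
have [le|lt] := leqP (first_prefix e i) j.
  by apply: cl_eq rj; apply: prefix_set_mono.
by apply/esym/cl_eq/esym/rj/prefix_set_mono/ltnW.
Qed.

Lemma is_flag_of : is_flag (flag_of e).
Proof.
apply/andP; split.
  apply/forallP=> i; rewrite tnth_mktuple flat_cl rank_cl.
  by have [_ ->] := @first_prefixP i (ltn_ord i); rewrite eqxx.
apply/(sortedP set0)=> i; rewrite size_tuple ltnS => lti.
rewrite !nth_flag_of ?(ltnW lti) //.
have [_ ri] := first_prefixP (ltnW lti); have [_ ri1] := first_prefixP lti.
rewrite properE; apply/andP; split.
  (* If the prefix chosen for [i] were the longer one, its rank would be at least [i.+1]. *)
  apply/clS/prefix_set_mono; rewrite leqNgt; apply/negP=> lt.
  by have := rank_mono M (prefix_set_mono e (ltnW lt)); rewrite ri ri1 ltnn.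
by apply/negP=> /(rank_mono M); rewrite !rank_cl ri ri1 ltnn.
Qed.

(** A prefix lies in the member indexed by its [top], which bounds its rank; conversely its closure
    is the member indexed by its rank, which bounds its [top]. *)
Lemma compatible_flag_of : compatible (flag_of e) e.
Proof.
move=> j lej; apply/eqP; rewrite eqn_leq; apply/andP; split.
  have let_ := top_level_max is_flag_of (take j e).
  rewrite -[leqRHS](rank_flag is_flag_of let_) rank_mono //.
  by rewrite -(top_level_leq is_flag_of).
rewrite (top_level_leq is_flag_of) ?rank_mono ?subsetT //.
by rewrite nth_flag_of_prefix // sub_cl.
Qed.

(** The member of [X] of rank [i] contains a prefix of rank [i], hence is its closure. *)
Lemma compatible_unique X : is_flag X -> compatible X e -> flag_of e = X.
Proof.
move=> flX cX; apply/val_inj/(@eq_from_nth _ set0); rewrite ?size_tuple // => i.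
rewrite ltnS => lei; rewrite nth_flag_of //.
have [lej rj] := first_prefixP lei.
apply: cl_eq_flat (flat_flag flX lei) _ _; last by rewrite rank_flag.
by rewrite -(top_level_leq flX) // -cX // rj.
Qed.

End FullOrdering.

Lemma topS e x (f : E -> nat) :
  top [seq f y | y <- rcons e x] = maxn (top [seq f y | y <- e]) (f x).
Proof. by rewrite map_rcons /top -cats1 big_cat big_seq1. Qed.

(** Induction along the prefixes: when rank and [top] both equal [i], the closure of the prefix is
    the [i]-th member of [X], so the next element keeps the rank exactly when its level is at most
    [i]. Otherwise the rank becomes [i.+1], and slowness forces the level to be [i.+1] too. *)
Lemma compatibleP X e :
  is_flag X -> reflect (compatible X e) (slow [seq level X x | x <- e]).
Proof.
move=> flX; rewrite /slow size_map; apply: (iffP allP) => [slw|cX].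
  elim=> [_|j IHj ltj].
    by rewrite rank_prefix0 take0 /top big_nil.
  have {IHj} := IHj (ltnW ltj); have := slw j; rewrite mem_iota -!map_take.
  move=> /(_ ltj); have [x -> ->] := prefix_setS ltj.
  rewrite topS => slx rj; set i := top _ in slx rj *.
  have lei : i <= rank M setT by rewrite -rj rank_mono ?subsetT.
  have sjX : prefix_set e j \subset nth set0 X i by rewrite -(top_level_leq flX).
  have clX := cl_eq_flat (flat_flag flX lei) sjX.
  move: clX; rewrite rank_flag // => /(_ rj) clX.
  have := level_leq flX x lei; rewrite -clX inE rj.
  have := rank_setU1 M x (prefix_set e j).
  have := rank_mono M (subsetUr [set x] (prefix_set e j)).
  rewrite rj; case: leqP; case: eqP => //; lia.
move=> j; rewrite mem_iota /= => ltj.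
by rewrite -!map_take -!cX ?(ltnW ltj) // rank_prefixS.
Qed.

Lemma compatible_rank_sequence X e :
  compatible X e -> rank_sequence M e = jumps [seq level X x | x <- e].
Proof.
move=> cX; rewrite /rank_sequence /jumps size_map; apply/eq_in_map=> i.
by rewrite mem_iota => /andP[lt0i ltie]; rewrite -!map_take -!cX //; lia.
Qed.

Lemma flag_of_eq X e : [set x in e] = setT -> is_flag X ->
  (flag_of e == X) = slow [seq level X x | x <- e].
Proof.
move=> full flX; apply/eqP/(compatibleP _ flX)=> [<-|].
  exact: compatible_flag_of.
exact: compatible_unique.
Qed.

End FlagOfOrdering.

(** * Sums over flags, by blocks of chains, and the invariant *)

Lemma sum_flags_chains (V : nmodType) (E : finType) (M : matroid E) (d : nat)
  (P : 'I_d -> {set {set {set E}}}) (G : seq nat -> V) :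
  injective P -> partition [set P i | i : 'I_d] (chains M) ->
  (\sum_(X : flagseq M | is_flag X) G (composition X)
    = \sum_i \sum_(c <- comp_mset (fl_set M (P i))) G c)%R.
Proof.
move=> injP /and3P[/eqP covP /trivIsetP trivP _].
transitivity (\sum_i \sum_(X in fl_set M (P i)) G (composition X))%R.
  (* With the sums exchanged, it remains to see that exactly one index has a block containing the
     reduced cyclic chain of a given flag. *)
  rewrite (exchange_big_dep (fun X : flagseq M => is_flag X)) /=; last first.
    by move=> i X _ /bigcupP[C _]; rewrite inE => /andP[].
  apply: eq_bigr => X flX.
  have : reduced_cyclic_chain X \in cover [set P i | i : 'I_d].
    by rewrite covP reduced_cyclic_chain_chains.
  case/bigcupP=> _ /imsetP[i _ ->] Pi; rewrite (big_pred1 i) // => j /=.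
  apply/bigcupP/eqP=> [[C PjC]|->].
    (* Injectivity of [P] makes blocks with distinct indices distinct, hence disjoint. *)
    rewrite inE => /andP[_ /eqP eC]; apply/eqP/negPn/negP=> neq.
    have := trivP (P j) (P i); rewrite !imset_f // inj_eq // => /(_ isT isT neq).
    by case/pred0P/(_ C)/andP; split; rewrite // -eC.
  by exists (reduced_cyclic_chain X); rewrite // inE flX eqxx.
apply: eq_bigr => i _; rewrite (perm_big _ (perm_eq_seq_mset _)) /=.
by rewrite big_map big_enum.
Qed.

Section GinvFlags.
Variable K : fieldType.
Local Open Scope ring_scope.

(* [w] lists the levels of the elements of an ordering; the symbol is [0] when
   the ordering does not build up the given flag. *)
Definition word_symbol (w : seq nat) : {malg K[seq bool]} :=
  if slow w then << jumps w >> else 0.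

(** Orderings are grouped by their flag. For a fixed flag, the sum then runs over all orderings,
    [word_symbol] discarding those that belong to another flag. *)
Lemma Ginv_flags (E : finType) (M : matroid E) :
  Ginv M K = \sum_(X : flagseq M | is_flag X)
               sum_arrangements word_symbol (comp_word (composition X)).
Proof.
have full (e : #|E|.-tuple E) : uniq e -> [set x in e] = setT.
  move=> ue; apply/eqP; rewrite eqEcard subsetT cardsT /= cardsE.
  by rewrite (card_uniqP ue) size_tuple.
rewrite /Ginv (partition_big (fun e : #|E|.-tuple E => flag_of M e)
  (fun X => is_flag X)) => [|e ue]; last exact/is_flag_of/full.
apply: eq_bigr => X flX; rewrite -sort_level // -sum_uniq_tuples.
rewrite big_mkcondr /=; apply: eq_bigr => e ue.
rewrite /word_symbol flag_of_eq ?full //; case: ifP => // /(compatibleP _ flX).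
by move=> /compatible_rank_sequence ->.
Qed.

End GinvFlags.

Theorem theorem3p3 (K : fieldType) (charK : [pchar K]%R =i pred0)
  (E F : finType) (M : matroid E) (N : matroid F)
  (loopsM : loops M = set0) (coloopsM : coloops M = set0)
  (loopsN : loops N = set0) (coloopsN : coloops N = set0)
  (d : nat)
  (P : 'I_d -> {set {set {set E}}}) (Q : 'I_d -> {set {set {set F}}})
  (injP : injective P)
  (partP : partition [set P i | i : 'I_d] (chains M))
  (injQ : injective Q)
  (partQ : partition [set Q i | i : 'I_d] (chains N))
  (compPQ : forall i : 'I_d,
     comp_mset (fl_set M (P i)) = comp_mset (fl_set N (Q i))) :
  Ginv M K = Ginv N K.
Proof.
(* The contribution of one flag of composition [c]; it mentions neither matroid, so equal multisets
   of compositions give equal sums. *)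
pose G c := sum_arrangements (word_symbol K) (comp_word c).
rewrite !Ginv_flags (sum_flags_chains G injP partP) (sum_flags_chains G injQ partQ).
by apply: eq_bigr => i _; rewrite compPQ.
Qed.
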